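(* Let $\beta>0$, let $s=-1$ (fermionic case) or $s=+1$ (bosonic case), and let $\nu,\xi,\mu$ range over a finite index set. Let $B^{\nu\xi}$ and $C^{\xi\mu}$ be functions given for $0<\tau<\beta$ by finite Chebyshev sums $B^{\nu\xi}(\tau)=\sum_{k} b_k^{\nu\xi}T_k(x(\tau))$ and $C^{\xi\mu}(\tau)=\sum_l c_l^{\xi\mu}T_l(x(\tau))$, where $x(\tau)=\frac{2\tau}{\beta}-1$, and extend $B$ to $-\beta<\tau<0$ by $B^{\nu\xi}(\tau)=s\,B^{\nu\xi}(\tau+\beta)$. Define $$A^{\nu\mu}(t)=\sum_\xi\int_0^\beta B^{\nu\xi}(t-\tau)\,C^{\xi\mu}(\tau)\,d\tau,\qquad 0\le t\le\beta .$$ Then $A^{\nu\mu}(t)=\tfrac12 a_0^{\nu\mu}+\sum_{j\ge1}a_j^{\nu\mu}T_j(x(t))$ for all $t\in[0,\beta]$, with $$a_j^{\nu\mu}=\frac{\beta}{2}\sum_{k,l,\xi} b_k^{\nu\xi}\,c_l^{\xi\mu}\,t^j_{kl},$$ where the numbers $t^j_{kl}$ are the Chebyshev coefficients defined by $$\int_{-1}^{x}T_k(x-y-1)T_l(y)\,dy+s\int_{x}^{1}T_k(x-y+1)T_l(y)\,dy=\tfrac12 t^0_{kl}+\sum_{j\ge1}t^j_{kl}T_j(x)\qquad(x\in[-1,1]).$$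
   Context: $T_j$ denotes the $j$-th Chebyshev polynomial of the first kind. The left side of the relation defining $t^j_{kl}$ is a polynomial in $x$, so only finitely many $t^j_{kl}$ are nonzero for each $k,l$. The coefficients $b_k,c_l$ may be real or complex. *)

(* Defs.v *)
From mathcomp Require Export all_boot.
From Stdlib Require Export Reals.
From Coquelicot Require Export Coquelicot.

Set Implicit Arguments.
Unset Strict Implicit.
Unset Printing Implicit Defensive.

Notation "\csum_ ( i 'in' T ) F" := (\big[Cplus/RtoC 0]_(i : T) F%C)
  (at level 41, F at level 41, i name, T at level 69,
   format "'[' \csum_ ( i  'in'  T ) '/  '  F ']'") : C_scope.

Open Scope R_scope.

Fixpoint cheb (n : nat) (x : R) : R :=
  match n with
  | 0%nat => 1
  | S m => match m with
           | 0%nat => x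
           | S p => 2 * x * cheb m x - cheb p x
           end
  end.

(* [f t = a_0 / 2 + \sum_(j >= 1) a_j T_j(x t)] for all [t] in [[lo, hi]], where
   only finitely many [a_j] are nonzero, so that the series is a finite sum.
   [V] is meant to be [R] or [C], seen as a real vector space. *)
Definition cheb_expansion (V : ModuleSpace R_Ring) (lo hi : R) (x : R -> R)
    (f : R -> V) (a : nat -> V) : Prop :=
  exists N : nat,
    (forall j : nat, (N < j)%nat -> a j = zero) /\
    (forall t : R, lo <= t <= hi ->
       f t = plus (scal (1 / 2) (a 0%nat))
                  (\big[plus/zero]_(1 <= j < N.+1) scal (cheb j (x t)) (a j))).

Definition cheb_conv (s : R) (k l : nat) (x : R) : R :=
  RInt (fun y => cheb k (x - y - 1) * cheb l y) (-1) x
  + s * RInt (fun y => cheb k (x - y + 1) * cheb l y) x 1.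

(* [u j] is the coefficient written $t^j_{kl}$ in the usual notation. *)
Definition conv_coefs (s : R) (k l : nat) (u : nat -> R) : Prop :=
  cheb_expansion (V := R_ModuleSpace) (-1) 1 (fun x => x) (cheb_conv s k l) u.

(* Main.v *)
Require Import Defs.
From HB Require Import structures.
From mathcomp Require Import all_boot.
From Stdlib Require Import Reals Lra FunctionalExtensionality.
From Coquelicot Require Import Coquelicot.
Set Implicit Arguments.
Unset Strict Implicit.
Unset Printing Implicit Defensive.

Open Scope R_scope.

(** Substituting [y = x tau] on [0 < tau < t] and on [t < tau < beta], where the
    (anti)periodicity of [B] contributes the factor [s], turns the convolution of
    [T_k] and [T_l] into [beta / 2 * cheb_conv s k l (x t)]; the formula for the
    coefficients is then bilinearity.

    The function [cheb_conv s k l] has a finite Chebyshev expansion because the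
    kernels [F x y] whose moments [fun x => RInt (fun y => F x y * y ^ i) _ _] all
    have one are stable under linear combinations and multiplication by [x] and
    [y], hence contain [T_k (x - y + d) * T_l y]. Coefficients are unique because
    the functions [cos (j th)] are linearly independent. *)

(** * Commutative monoid laws behind the iterated sums *)

HB.instance Definition _ (V : AbelianMonoid) :=
  Monoid.isComLaw.Build V zero plus (@plus_assoc V) (@plus_comm V) (@plus_zero_l V).
HB.instance Definition _ :=
  Monoid.isComLaw.Build R 0 Rplus (fun x y z => esym (Rplus_assoc x y z)) Rplus_comm Rplus_0_l.
HB.instance Definition _ :=
  Monoid.isComLaw.Build C (RtoC 0) Cplus Cplus_assoc Cplus_comm Cplus_0_l.

(** * Linear operations on finite Chebyshev expansions *)

Section Expansion.

Variables (lo hi : R) (x : R -> R).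

(** Coefficients past the truncation bound vanish, so the bound can be raised at will; two
    expansions are then compared at a common bound. *)
Lemma cheb_expansion_widen (V : ModuleSpace R_Ring) (f : R -> V) (a : nat -> V) :
  cheb_expansion lo hi x f a ->
  exists N : nat, forall M : nat, (N <= M)%nat ->
    (forall j : nat, (M < j)%nat -> a j = zero) /\
    (forall t : R, lo <= t <= hi ->
       f t = plus (scal (1 / 2) (a 0%nat))
                  (\big[plus/zero]_(1 <= j < M.+1) scal (cheb j (x t)) (a j))).
Proof.
move=> [N [a0 fE]]; exists N => M NM; split=> [j Mj | t ht].
  by apply: a0; apply: leq_ltn_trans Mj.
rewrite fE // [in RHS](@big_cat_nat _ _ _ N.+1) //=.
rewrite [X in _ = plus _ (plus _ X)]big1_seq ?plus_zero_r // => j /andP[_].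
by rewrite mem_index_iota => /andP[Nj _]; rewrite a0 // scal_zero_r.
Qed.

Lemma cheb_expansion_ext (V : ModuleSpace R_Ring) (f g : R -> V) (a b : nat -> V) :
  (forall t, lo <= t <= hi -> g t = f t) -> (forall j, b j = a j) ->
  cheb_expansion lo hi x f a -> cheb_expansion lo hi x g b.
Proof.
move=> gf ba [N [a0 fE]]; exists N; split=> [j Nj | t ht]; first by rewrite ba a0.
by rewrite gf // fE // ba; congr plus; apply: eq_bigr => j _; rewrite ba.
Qed.

Lemma cheb_expansion_zero (V : ModuleSpace R_Ring) :
  cheb_expansion lo hi x (fun _ => zero : V) (fun _ => zero).
Proof.
exists 0%nat; split=> // t _.
by rewrite big_geq // scal_zero_r plus_zero_r.
Qed.

Lemma cheb_expansion_plus (V : ModuleSpace R_Ring) (f g : R -> V) (a b : nat -> V) :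
  cheb_expansion lo hi x f a -> cheb_expansion lo hi x g b ->
  cheb_expansion lo hi x (fun t => plus (f t) (g t)) (fun j => plus (a j) (b j)).
Proof.
move=> /cheb_expansion_widen[N HN] /cheb_expansion_widen[M HM].
have [a0 fE] := HN _ (leq_maxl N M); have [b0 gE] := HM _ (leq_maxr N M).
exists (maxn N M); split=> [j hj | t ht]; first by rewrite a0 // b0 // plus_zero_r.
rewrite fE // gE // scal_distr_l.
under [in RHS]eq_bigr => j _ do rewrite scal_distr_l.
rewrite big_split /= -!plus_assoc; congr plus.
by rewrite !plus_assoc; congr plus; rewrite plus_comm.
Qed.

Lemma cheb_expansion_sum (V : ModuleSpace R_Ring) (J : Type) (r : seq J)
    (f : J -> R -> V) (a : J -> nat -> V) :
  (forall i, cheb_expansion lo hi x (f i) (a i)) ->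
  cheb_expansion lo hi x (fun t => \big[plus/zero]_(i <- r) f i t)
                         (fun j => \big[plus/zero]_(i <- r) a i j).
Proof.
move=> H; elim: r => [|i r IHr].
  by apply: (cheb_expansion_ext _ _ (cheb_expansion_zero V)) => *; rewrite big_nil.
by apply: (cheb_expansion_ext _ _ (cheb_expansion_plus (H i) IHr)) => *; rewrite big_cons.
Qed.

(** Besides scaling real expansions, this carries the real expansion of [cheb_conv] to a complex
    one, with [phi] multiplication by a fixed complex number. *)
Lemma cheb_expansion_linear (V W : ModuleSpace R_Ring) (phi : V -> W)
    (f : R -> V) (a : nat -> V) :
  (forall u v, phi (plus u v) = plus (phi u) (phi v)) ->
  (forall (r : R) v, phi (scal r v) = scal r (phi v)) ->
  cheb_expansion lo hi x f a ->
  cheb_expansion lo hi x (fun t => phi (f t)) (fun j => phi (a j)).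
Proof.
move=> phiD phiZ [N [a0 fE]].
have phi0 : phi zero = zero.
  by rewrite -(@scal_zero_l _ V zero) phiZ scal_zero_l.
exists N; split=> [j hj | t ht]; first by rewrite a0.
rewrite fE // phiD phiZ (big_morph phi phiD phi0); congr plus.
by apply: eq_bigr => j _; rewrite phiZ.
Qed.

Lemma cheb_expansion_comp (V : ModuleSpace R_Ring) (f : R -> V) (a : nat -> V) :
  (forall t, lo <= t <= hi -> -1 <= x t <= 1) ->
  cheb_expansion (-1) 1 (fun y => y) f a ->
  cheb_expansion lo hi x (fun t => f (x t)) a.
Proof.
move=> hx [N [a0 fE]]; exists N; split=> // t ht; rewrite fE //; exact: hx.
Qed.

End Expansion.

(** * Real functions with a finite Chebyshev expansion on [-1, 1] *)

Definition cheb_poly (f : R -> R) : Prop :=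
  exists u, cheb_expansion (V := R_ModuleSpace) (-1) 1 (fun x => x) f u.

Lemma cheb_poly_ext (f g : R -> R) :
  (forall x, -1 <= x <= 1 -> g x = f x) -> cheb_poly f -> cheb_poly g.
Proof. by move=> gf [u fu]; exists u; apply: (cheb_expansion_ext gf _ fu). Qed.

Lemma cheb_poly_plus (f g : R -> R) :
  cheb_poly f -> cheb_poly g -> cheb_poly (fun x => f x + g x).
Proof. by move=> [u fu] [v gv]; exists (fun j => plus (u j) (v j)); exact: cheb_expansion_plus. Qed.

Lemma cheb_poly_scal (r : R) (f : R -> R) : cheb_poly f -> cheb_poly (fun x => r * f x).
Proof.
move=> [u fu]; exists (fun j => r * u j).
apply: (cheb_expansion_linear (V := R_ModuleSpace) (W := R_ModuleSpace) (phi := Rmult r)) fu.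
- by move=> v w; rewrite /plus /=; ring.
- by move=> q v; rewrite /scal /= /mult /=; ring.
Qed.

Lemma cheb_poly_cheb (n : nat) : cheb_poly (cheb n).
Proof.
(* The value 2 for [n = 0] compensates for the halving of the zeroth coefficient. *)
exists (fun j => if j == n then (if n == 0%nat then 2 else 1) else 0).
exists n; split=> [j hj | t ht]; first by rewrite gtn_eqF.
case: n => [|n] /=.
  by rewrite big_geq // plus_zero_r /scal /= /mult /=; field.
rewrite scal_zero_r plus_zero_l big_nat_recr //= eqxx.
rewrite [X in plus X _]big1_seq ?plus_zero_l => [|j /andP[_]].
  by rewrite /scal /= /mult /= Rmult_1_r.
by rewrite mem_index_iota => /andP[_ hj]; rewrite ltn_eqF // scal_zero_r.
Qed.

Lemma cheb_poly_sum (J : Type) (r : seq J) (f : J -> R -> R) :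
  (forall i, cheb_poly (f i)) -> cheb_poly (fun x => \big[Rplus/0]_(i <- r) f i x).
Proof.
move=> H; elim: r => [|i r IHr].
  apply: (cheb_poly_ext (f := fun x => 0 * cheb 0 x)).
    by move=> t _; rewrite big_nil Rmult_0_l.
  exact/cheb_poly_scal/cheb_poly_cheb.
by apply: (cheb_poly_ext _ (cheb_poly_plus (H i) IHr)) => *; rewrite big_cons.
Qed.

(** By linearity it is enough to treat each T_n: x T_0 = T_1, and x T_(n+1) = (T_(n+2) + T_n) / 2 by
    the recurrence. *)
Lemma cheb_poly_mulX (f : R -> R) : cheb_poly f -> cheb_poly (fun x => x * f x).
Proof.
have HT n : cheb_poly (fun x => x * cheb n x).
  case: n => [|n].
    by apply: (cheb_poly_ext _ (cheb_poly_cheb 1)) => x _ /=; ring.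
  apply: (cheb_poly_ext _ (cheb_poly_scal (1 / 2)
    (cheb_poly_plus (cheb_poly_cheb n.+2) (cheb_poly_cheb n)))) => x _ /=.
  by field.
move=> [u [N [_ fE]]].
apply: (cheb_poly_ext (f := fun x => (1 / 2 * u 0%nat) * (x * cheb 0 x) +
    \big[Rplus/0]_(1 <= j < N.+1) (u j * (x * cheb j x)))).
  move=> x hx; rewrite fE // /plus /scal /= /mult /= Rmult_plus_distr_l; congr Rplus.
    by ring.
  rewrite (big_morph (Rmult x) (Rmult_plus_distr_l x) (Rmult_0_r x)).
  by apply: eq_bigr => j _; ring.
apply: cheb_poly_plus; first exact/cheb_poly_scal/HT.
by apply: cheb_poly_sum => j; apply/cheb_poly_scal/HT.
Qed.

Lemma cheb_poly_const (r : R) : cheb_poly (fun _ => r).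
Proof.
by apply: (cheb_poly_ext _ (cheb_poly_scal r (cheb_poly_cheb 0))) => x _ /=; ring.
Qed.

Lemma cheb_poly_pow (f : R -> R) (n : nat) :
  (forall g, cheb_poly g -> cheb_poly (fun x => f x * g x)) ->
  cheb_poly (fun x => f x ^ n).
Proof.
by move=> Hf; elim: n => [|n IHn]; [exact: cheb_poly_const | exact: Hf].
Qed.

(** * Kernels with polynomial moments between moving endpoints *)

Section PartialMoments.

Variables a b : R -> R.
Hypothesis a_pow : forall n, cheb_poly (fun x => a x ^ n).
Hypothesis b_pow : forall n, cheb_poly (fun x => b x ^ n).

(** Asking for all moments, not just the integral of [F x], makes the class stable under
    multiplication by [y], which only shifts [i]. Using [is_RInt] carries integrability along. *)
Definition poly_moments (F : R -> R -> R) : Prop :=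
  forall i : nat, exists q, cheb_poly q /\
    forall x, is_RInt (fun y => F x y * y ^ i) (a x) (b x) (q x).

Lemma poly_moments_ext (F G : R -> R -> R) :
  (forall x y, G x y = F x y) -> poly_moments F -> poly_moments G.
Proof.
move=> GF HF i; have [q [qP qI]] := HF i; exists q; split=> // x.
by apply: is_RInt_ext (qI x) => y _; rewrite GF.
Qed.

Lemma poly_moments1 : poly_moments (fun _ _ => 1).
Proof.
move=> i; exists (fun x => / INR i.+1 * b x ^ i.+1 + - / INR i.+1 * a x ^ i.+1); split.
  by apply: cheb_poly_plus; apply: cheb_poly_scal.
move=> x.
have i0 : INR i.+1 <> 0 by exact: not_0_INR.
have -> : / INR i.+1 * b x ^ i.+1 + - / INR i.+1 * a x ^ i.+1 =
    minus (/ INR i.+1 * b x ^ i.+1) (/ INR i.+1 * a x ^ i.+1).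
  by rewrite /minus /plus /opp /=; ring.
apply: (is_RInt_derive (fun y => / INR i.+1 * y ^ i.+1)) => y _; last first.
  by apply: ex_derive_continuous; auto_derive.
(* The [match] is [INR i.+1] unfolded; folding it back lets [field] cancel it using [i0]. *)
auto_derive => //; change (match i with O => 1 | S _ => INR i + 1 end) with (INR i.+1).
by field.
Qed.

Lemma poly_moments_lin (r : R) (F G : R -> R -> R) :
  poly_moments F -> poly_moments G -> poly_moments (fun x y => r * F x y + G x y).
Proof.
move=> HF HG i; have [p [pP pI]] := HF i; have [q [qP qI]] := HG i.
exists (fun x => r * p x + q x); split.
  by apply: cheb_poly_plus => //; exact: cheb_poly_scal.
move=> x; apply: is_RInt_ext (is_RInt_plus _ _ _ _ _ _ (is_RInt_scal _ _ _ r _ (pI x)) (qI x)) => y _.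
by rewrite /plus /scal /= /mult /=; ring.
Qed.

Lemma poly_moments_mulx (F : R -> R -> R) :
  poly_moments F -> poly_moments (fun x y => x * F x y).
Proof.
move=> HF i; have [q [qP qI]] := HF i; exists (fun x => x * q x); split.
  exact: cheb_poly_mulX.
move=> x; apply: is_RInt_ext (is_RInt_scal _ _ _ x _ (qI x)) => y _.
by rewrite /scal /= /mult /=; ring.
Qed.

Lemma poly_moments_muly (F : R -> R -> R) :
  poly_moments F -> poly_moments (fun x y => y * F x y).
Proof.
move=> HF i; have [q [qP qI]] := HF i.+1; exists q; split=> // x.
by apply: is_RInt_ext (qI x) => y _ /=; ring.
Qed.

(** The three-term recurrence needs only multiplication by [h] and linear combinations. It serves
    with [h] equal to [y] and to [x - y + d]; the induction carries two consecutive degrees. *)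
Lemma poly_moments_cheb (h F : R -> R -> R) (n : nat) :
  (forall G, poly_moments G -> poly_moments (fun x y => h x y * G x y)) ->
  poly_moments F -> poly_moments (fun x y => cheb n (h x y) * F x y).
Proof.
move=> Hh HF.
suff [] : poly_moments (fun x y => cheb n (h x y) * F x y) /\
          poly_moments (fun x y => cheb n.+1 (h x y) * F x y) by [].
elim: n => [|n [IH0 IH1]]; split=> //.
- by apply: poly_moments_ext HF => x y /=; ring.
- by apply: poly_moments_ext (Hh _ HF) => x y /=; ring.
have H := poly_moments_lin (-1) IH0 (poly_moments_lin 1 (Hh _ IH1) (Hh _ IH1)).
by apply: poly_moments_ext H => x y /=; ring.
Qed.

Lemma poly_moments_conv (k l : nat) (d : R) :
  poly_moments (fun x y => cheb k (x - y + d) * cheb l y).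
Proof.
have Hl : poly_moments (fun _ y => cheb l y).
  have H := poly_moments_cheb (h := fun _ y => y) l poly_moments_muly poly_moments1.
  by apply: poly_moments_ext H => x y; ring.
apply: (poly_moments_cheb (h := fun x y => x - y + d)) Hl => G HG.
have H := poly_moments_lin d HG
  (poly_moments_lin (-1) (poly_moments_muly HG) (poly_moments_mulx HG)).
by apply: poly_moments_ext H => x y; ring.
Qed.

Lemma poly_moments_RInt (F : R -> R -> R) : poly_moments F ->
  cheb_poly (fun x => RInt (F x) (a x) (b x)) /\
  forall x, is_RInt (F x) (a x) (b x) (RInt (F x) (a x) (b x)).
Proof.
move=> HF; have [q [qP qI]] := HF 0%nat.
have qI' x : is_RInt (F x) (a x) (b x) (q x).
  by apply: is_RInt_ext (qI x) => y _ /=; ring.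
split=> [|x]; first by apply: cheb_poly_ext qP => x _; exact: is_RInt_unique.
by rewrite (is_RInt_unique _ _ _ _ (qI' x)).
Qed.

End PartialMoments.

(** * Existence of the expansion of [cheb_conv] *)

Lemma cheb_poly_pow_id (n : nat) : cheb_poly (fun x => x ^ n).
Proof. by apply: cheb_poly_pow => g; exact: cheb_poly_mulX. Qed.

Lemma cheb_conv_left (k l : nat) :
  cheb_poly (fun x => RInt (fun y => cheb k (x - y - 1) * cheb l y) (-1) x) /\
  forall x, is_RInt (fun y => cheb k (x - y - 1) * cheb l y) (-1) x
    (RInt (fun y => cheb k (x - y - 1) * cheb l y) (-1) x).
Proof.
apply: (poly_moments_RInt (a := fun _ => -1) (b := fun x => x)).
apply: poly_moments_conv => n; [exact: cheb_poly_const | exact: cheb_poly_pow_id].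
Qed.

Lemma cheb_conv_right (k l : nat) :
  cheb_poly (fun x => RInt (fun y => cheb k (x - y + 1) * cheb l y) x 1) /\
  forall x, is_RInt (fun y => cheb k (x - y + 1) * cheb l y) x 1
    (RInt (fun y => cheb k (x - y + 1) * cheb l y) x 1).
Proof.
apply: (poly_moments_RInt (a := fun x => x) (b := fun _ => 1)).
apply: poly_moments_conv => n; [exact: cheb_poly_pow_id | exact: cheb_poly_const].
Qed.

Lemma cheb_poly_conv (s : R) (k l : nat) : cheb_poly (cheb_conv s k l).
Proof.
apply: cheb_poly_plus; first by case: (cheb_conv_left k l).
by apply: cheb_poly_scal; case: (cheb_conv_right k l).
Qed.

(** * Uniqueness of Chebyshev coefficients *)

Lemma cheb_cos (n : nat) (th : R) : cheb n (cos th) = cos (INR n * th).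
Proof.
suff [] : cheb n (cos th) = cos (INR n * th) /\
          cheb n.+1 (cos th) = cos (INR n.+1 * th) by [].
elim: n => [|n [IH0 IH1]]; first by rewrite /= Rmult_0_l cos_0 Rmult_1_l.
split=> //; rewrite -[LHS]/(2 * cos th * cheb n.+1 (cos th) - cheb n (cos th)).
rewrite IH0 IH1.
have -> : INR n.+2 * th = INR n.+1 * th + th by rewrite (S_INR n.+1); ring.
have -> : INR n * th = INR n.+1 * th - th by rewrite (S_INR n); ring.
by rewrite cos_plus cos_minus; ring.
Qed.

(* Applying [f |-> f (th + h) + f (th - h) - 2 cos (N h) f th] with [h = PI / N]
   kills the top term and multiplies the [j]-th one by [2 (cos (j h) + 1) > 0]. *)
Lemma cos_sum_inj (N : nat) (w : nat -> R) :
  (forall th, \big[Rplus/0]_(j < N) (w j * cos (INR j * th)) = 0) ->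
  forall j, (j < N)%nat -> w j = 0.
Proof.
elim: N w => [//|N IHN] w Hw.
have low : forall j, (j < N)%nat -> w j = 0.
  case: N IHN Hw => [//|N] IHN Hw j jN.
  set h := PI / INR N.+1.
  have N0 : 0 < INR N.+1 by apply: lt_0_INR; apply/ltP.
  have /(IHN (fun j => w j * (cos (INR j * h) + 1)))/(_ j jN) : forall th, \big[Rplus/0]_(j < N.+1)
      (w j * (cos (INR j * h) + 1) * cos (INR j * th)) = 0.
    move=> th.
    have E : \big[Rplus/0]_(j < N.+2) (w j * cos (INR j * (th + h))) +
      (\big[Rplus/0]_(j < N.+2) (w j * cos (INR j * (th - h))) +
       2 * \big[Rplus/0]_(j < N.+2) (w j * cos (INR j * th))) = 0.
      by rewrite !Hw; ring.
    move: E.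
    rewrite (big_morph (Rmult 2) (Rmult_plus_distr_l 2) (Rmult_0_r 2)) -!big_split /=.
    under eq_bigr => i _.
      have -> : w i * cos (INR i * (th + h)) + (w i * cos (INR i * (th - h)) +
          2 * (w i * cos (INR i * th))) =
        2 * (w i * (cos (INR i * h) + 1) * cos (INR i * th)).
        rewrite Rmult_plus_distr_l Rmult_minus_distr_l cos_plus cos_minus; ring.
      over.
    rewrite -(big_morph (Rmult 2) (Rmult_plus_distr_l 2) (Rmult_0_r 2)).
    rewrite big_ord_recr /=; change (match N with O => 1 | S _ => INR N + 1 end) with (INR N.+1).
    have -> : INR N.+1 * h = PI by rewrite /h; field; lra.
    rewrite cos_PI; lra.
  move/Rmult_integral => [//|] E; exfalso.
  have jh : INR j * h < PI.
    rewrite /h; apply: (Rmult_lt_reg_r (INR N.+1)) => //.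
    have -> : INR j * (PI / INR N.+1) * INR N.+1 = PI * INR j by field; lra.
    apply: Rmult_lt_compat_l; [exact: PI_RGT_0 | apply: lt_INR; exact/ltP].
  have jh0 : 0 <= INR j * h.
    apply: Rmult_le_pos; [exact: pos_INR|].
    by apply: Rlt_le; apply: Rdiv_lt_0_compat => //; exact: PI_RGT_0.
  have := PI_RGT_0 => pi0.
  have : cos PI < cos (INR j * h) by apply: cos_decreasing_1; lra.
  rewrite cos_PI; lra.
move=> j; rewrite ltnS leq_eqVlt => /orP[/eqP ->|/low //].
(* With all lower weights zero, evaluating at angle 0 isolates the top weight. *)
have := Hw 0; rewrite big_ord_recr /= big1 => [|i _]; last by rewrite low // Rmult_0_l.
rewrite Rmult_0_r cos_0; lra.
Qed.

(** At x = cos th the difference of the two expansions is a cosine sum that vanishes for every th,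
    so [cos_sum_inj] applies. *)
Lemma cheb_expansion_inj (f : R -> R) (u v : nat -> R) :
  cheb_expansion (V := R_ModuleSpace) (-1) 1 (fun x => x) f u ->
  cheb_expansion (V := R_ModuleSpace) (-1) 1 (fun x => x) f v ->
  u = v.
Proof.
move=> /cheb_expansion_widen[N HN] /cheb_expansion_widen[M HM].
have [u0 uE] := HN _ (leq_maxl N M); have [v0 vE] := HM _ (leq_maxr N M).
set P := maxn N M in u0 uE v0 vE.
(* The weight absorbs the factor 1/2 of the constant term, giving one uniform sum from index 0. *)
pose w j := (if j == 0%nat then 1 / 2 else 1) * (u j - v j).
have /cos_sum_inj Hw : forall th, \big[Rplus/0]_(j < P.+1) (w j * cos (INR j * th)) = 0.
  move=> th; have hc := COS_bound th.
  have E : 1 / 2 * v 0%nat + \big[Rplus/0]_(1 <= j < P.+1) (cheb j (cos th) * v j) =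
           1 / 2 * u 0%nat + \big[Rplus/0]_(1 <= j < P.+1) (cheb j (cos th) * u j).
    by rewrite -[LHS](vE _ hc) -[RHS](uE _ hc).
  rewrite -(big_mkord xpredT (fun j => w j * cos (INR j * th))) big_ltn //.
  have {}E : 1 / 2 * u 0%nat - 1 / 2 * v 0%nat +
    (\big[Rplus/0]_(1 <= j < P.+1) (cheb j (cos th) * u j) +
     -1 * \big[Rplus/0]_(1 <= j < P.+1) (cheb j (cos th) * v j)) = 0 by lra.
  rewrite -[RHS]E (big_morph (Rmult (-1)) (Rmult_plus_distr_l (-1)) (Rmult_0_r (-1))).
  rewrite -big_split /=; congr Rplus.
    by rewrite /w /= Rmult_0_l cos_0; ring.
  apply: eq_big_nat => j /andP[j1 _].
  by rewrite /w gtn_eqF // cheb_cos; ring.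
apply: functional_extensionality => j.
case: (leqP j P) => hj; last by rewrite u0 // v0.
have := Hw j hj; rewrite /w; case: (j == 0%nat) => H; lra.
Qed.

(* [ring] does not recognise [C] behind the canonical structures of Coquelicot. *)
Ltac C_ring := lazymatch goal with |- ?u = ?v => change (u = v :> C) end; ring.

(** * Complex-valued integrals and the convolution integral *)

Lemma is_RInt_Csum (J : Type) (r : seq J) (f : J -> R -> C) (a b : R) (v : J -> C) :
  (forall i, is_RInt (V := C_R_NormedModule) (f i) a b (v i)) ->
  is_RInt (V := C_R_NormedModule) (fun t => \big[Cplus/RtoC 0]_(i <- r) f i t) a b
          (\big[Cplus/RtoC 0]_(i <- r) v i).
Proof.
move=> H; elim: r => [|i r IHr].
  rewrite big_nil; apply: (is_RInt_ext (V := C_R_NormedModule) (fun _ => zero)).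
    by move=> t _; rewrite big_nil.
  have := is_RInt_const (V := C_R_NormedModule) a b zero.
  by rewrite scal_zero_r.
rewrite big_cons.
apply: is_RInt_ext (is_RInt_plus (V := C_R_NormedModule) _ _ _ _ _ _ (H i) IHr) => t _.
by rewrite big_cons.
Qed.

(** The integral is taken componentwise in R x R, and each component of the integrand is a real
    multiple of [f]. *)
Lemma is_RInt_CmulR (z : C) (f : R -> R) (a b v : R) :
  is_RInt f a b v ->
  is_RInt (V := C_R_NormedModule) (fun t => (z * RtoC (f t))%C) a b (z * RtoC v)%C.
Proof.
move=> H; case: z => p q.
have E y : ((p, q) * RtoC y)%C = (p * y, q * y).
  by rewrite /Cmult /RtoC /=; congr pair; ring.
rewrite E; apply: (is_RInt_fct_extend_pair (U := R_NormedModule) (V := R_NormedModule)).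
  by apply: is_RInt_ext (is_RInt_scal _ _ _ p _ H) => t _; rewrite E.
by apply: is_RInt_ext (is_RInt_scal _ _ _ q _ H) => t _; rewrite E.
Qed.

Lemma is_RInt_conv (beta s t : R) (f g : R -> C) (K L : nat) (b c : nat -> C)
    (x : R -> R) :
  0 < beta -> 0 <= t <= beta ->
  (forall tau, x tau = 2 * tau / beta - 1) ->
  (forall tau, 0 < tau < beta ->
     f tau = (\csum_(k in 'I_K) b k * RtoC (cheb k (x tau)))%C) ->
  (forall tau, - beta < tau < 0 -> f tau = (RtoC s * f (tau + beta)%R)%C) ->
  (forall tau, 0 < tau < beta ->
     g tau = (\csum_(l in 'I_L) c l * RtoC (cheb l (x tau)))%C) ->
  is_RInt (V := C_R_NormedModule) (fun tau => (f (t - tau)%R * g tau)%C) 0 beta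
    (\csum_(k in 'I_K) \csum_(l in 'I_L)
       (RtoC (beta / 2) * (b k * c l) * RtoC (cheb_conv s k l (x t))))%C.
Proof.
move=> beta0 ht hx hf hext hg.
(* Affine substitution: [x] has slope 2 / beta, whence the factor [beta / 2]. *)
have xlin u v F w : is_RInt F (x u) (x v) w ->
    is_RInt (fun tau => F (x tau)) u v (beta / 2 * w).
  have xE tau : 2 / beta * tau + -1 = x tau by rewrite hx; field; lra.
  rewrite -!xE => /is_RInt_comp_lin H.
  apply: is_RInt_ext (is_RInt_scal _ _ _ (beta / 2) _ H) => y _.
  by rewrite /scal /= /mult /= xE; field; lra.
have x0 : x 0 = -1 by rewrite hx; field; lra.
have xb : x beta = 1 by rewrite hx; field; lra.
have prodE (u v : nat -> R) :
    ((\csum_(k in 'I_K) b k * RtoC (u k)) * (\csum_(l in 'I_L) c l * RtoC (v l)) =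
     \csum_(k in 'I_K) \csum_(l in 'I_L) (b k * c l * RtoC (u k * v l)%R))%C.
  rewrite (big_morph (fun z => Cmult z _) (fun y z => Cmult_plus_distr_r y z _)
    (Cmult_0_l _)).
  apply: eq_bigr => k _.
  rewrite (big_morph (Cmult _) (Cmult_plus_distr_l _) (Cmult_0_r _)).
  by apply: eq_bigr => l _; rewrite RtoC_mult; ring.
(* For 0 < tau < t the argument t - tau lies in (0, beta), and x(t - tau) = x(t) - x(tau) - 1. Only
   the open interval matters to [is_RInt_ext], so the unspecified values of [f] at 0 and of [g] at 0
   and beta do no harm. *)
have Hl : is_RInt (V := C_R_NormedModule) (fun tau => (f (t - tau)%R * g tau)%C) 0 t
    (\csum_(k in 'I_K) \csum_(l in 'I_L) (b k * c l * RtoC (beta / 2 *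
       RInt (fun y => cheb k (x t - y - 1) * cheb l y) (-1) (x t))%R))%C.
  apply: (is_RInt_ext (V := C_R_NormedModule) (fun tau =>
    \csum_(k in 'I_K) \csum_(l in 'I_L) (b k * c l *
      RtoC (cheb k (x t - x tau - 1) * cheb l (x tau))%R))%C).
    move=> tau; rewrite Rmin_left ?Rmax_right; try lra; move=> htau.
    rewrite hf ?hg; try lra.
    rewrite -(prodE (fun k => cheb k (x t - x tau - 1)) (fun l => cheb l (x tau))); congr Cmult; apply: eq_bigr => k _.
    by do 3 f_equal; rewrite !hx; field; lra.
  apply: is_RInt_Csum => k; apply: is_RInt_Csum => l; apply: is_RInt_CmulR.
  apply: (xlin _ _ (fun y => cheb k (x t - y - 1) * cheb l y)); rewrite x0.
  by case: (cheb_conv_left k l) => _; apply.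
(* For t < tau < beta the argument t - tau lies in (-beta, 0); shifting it by beta yields the factor
   [s], and x(t - tau + beta) = x(t) - x(tau) + 1. *)
have Hr : is_RInt (V := C_R_NormedModule) (fun tau => (f (t - tau)%R * g tau)%C) t beta
    (\csum_(k in 'I_K) \csum_(l in 'I_L) (RtoC s * (b k * c l) * RtoC (beta / 2 *
       RInt (fun y => cheb k (x t - y + 1) * cheb l y) (x t) 1)%R))%C.
  apply: (is_RInt_ext (V := C_R_NormedModule) (fun tau =>
    \csum_(k in 'I_K) \csum_(l in 'I_L) (RtoC s * (b k * c l) *
      RtoC (cheb k (x t - x tau + 1) * cheb l (x tau))%R))%C).
    move=> tau; rewrite Rmin_left ?Rmax_right; try lra; move=> htau.
    rewrite hext ?hf ?hg; try lra; rewrite -Cmult_assoc.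
    have -> : (\csum_(k in 'I_K) b k * RtoC (cheb k (x (t - tau + beta)%R)))%C =
        (\csum_(k in 'I_K) b k * RtoC (cheb k (x t - x tau + 1)%R))%C.
      apply: eq_bigr => k _.
      by do 3 f_equal; rewrite !hx; field; lra.
    rewrite (prodE (fun k => cheb k (x t - x tau + 1)) (fun l => cheb l (x tau))).
    rewrite (big_morph (Cmult _) (Cmult_plus_distr_l _) (Cmult_0_r _)).
    apply: eq_bigr => k _.
    rewrite (big_morph (Cmult _) (Cmult_plus_distr_l _) (Cmult_0_r _)).
    by apply: eq_bigr => l _; C_ring.
  apply: is_RInt_Csum => k; apply: is_RInt_Csum => l; apply: is_RInt_CmulR.
  apply: (xlin _ _ (fun y => cheb k (x t - y + 1) * cheb l y)); rewrite xb.
  by case: (cheb_conv_right k l) => _; apply.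
(* Gluing at t: for each k and l the two partial integrals add up to the two terms of
   [cheb_conv]. *)
have := is_RInt_Chasles _ _ _ _ _ _ Hl Hr; rewrite /plus /= -[prod_plus _ _]/(Cplus _ _).
rewrite -big_split /=.
congr is_RInt; apply: eq_bigr => k _; rewrite -big_split; apply: eq_bigr => l _ /=.
by rewrite /cheb_conv RtoC_plus !RtoC_mult; ring.
Qed.

(** * The coefficient formula for the convolution *)

Theorem mainTheorem1 (beta : R) (hbeta : 0 < beta)
  (s : R) (hs : s = -1 \/ s = 1)
  (I : finType)
  (K L : nat) (b c : I -> I -> nat -> C)
  (x : R -> R) (hx : forall tau : R, x tau = 2 * tau / beta - 1)
  (fB fC fA : I -> I -> R -> C)
  (hB : forall (nu xi : I) (tau : R), 0 < tau < beta ->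
     fB nu xi tau = (\csum_(k in 'I_K) b nu xi k * RtoC (cheb k (x tau)))%C)
  (hBext : forall (nu xi : I) (tau : R), - beta < tau < 0 ->
     fB nu xi tau = (RtoC s * fB nu xi (tau + beta)%R)%C)
  (hC : forall (xi mu : I) (tau : R), 0 < tau < beta ->
     fC xi mu tau = (\csum_(l in 'I_L) c xi mu l * RtoC (cheb l (x tau)))%C)
  (hA : forall (nu mu : I) (t : R), 0 <= t <= beta ->
     fA nu mu t =
       (\csum_(xi in I)
          RInt (V := C_R_CompleteNormedModule)
            (fun tau => fB nu xi (t - tau)%R * fC xi mu tau) 0 beta)%C) :
  (* the integrals defining A exist *)
  (forall (nu xi mu : I) (t : R), 0 <= t <= beta ->
     ex_RInt (V := C_R_NormedModule)
       (fun tau => (fB nu xi (t - tau)%R * fC xi mu tau)%C) 0 beta) /\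
  (* the coefficients t^j_{kl} are well defined *)
  (forall k l : nat, exists! u : nat -> R, conv_coefs s k l u) /\
  (forall tc : nat -> nat -> nat -> R,
     (forall k l : nat, conv_coefs s k l (tc k l)) ->
     forall nu mu : I,
     cheb_expansion (V := C_R_ModuleSpace) 0 beta x (fA nu mu)
       (fun j : nat =>
          (RtoC (beta / 2) *
             \csum_(k in 'I_K) \csum_(l in 'I_L) \csum_(xi in I)
                (b nu xi k * c xi mu l * RtoC (tc k l j)))%C)).
Proof.
have HI nu xi mu t (ht : 0 <= t <= beta) :=
  is_RInt_conv hbeta ht hx (hB nu xi) (hBext nu xi) (hC xi mu).
split; [|split].
- by move=> nu xi mu t ht; eexists; exact: HI.
- move=> k l; have [u hu] := cheb_poly_conv s k l.
  by exists u; split=> // v hv; exact: cheb_expansion_inj hu hv.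
move=> tc htc nu mu.
have hxt t : 0 <= t <= beta -> -1 <= x t <= 1.
  move=> ht; rewrite hx; have : 0 <= t / beta <= 1.
    by split; [apply: Rdiv_le_0_compat; lra | apply/(Rdiv_le_1 t beta); lra].
  rewrite /Rdiv; lra.
(* The expansion for a single triple (k, l, xi): pull [htc k l] back along [x] and apply the
   real-linear map from R to C that multiplies by the fixed complex factor. *)
have Hterm k l xi : cheb_expansion (V := C_R_ModuleSpace) 0 beta x
    (fun t => RtoC (beta / 2) * (b nu xi k * c xi mu l) * RtoC (cheb_conv s k l (x t)))%C
    (fun j => RtoC (beta / 2) * (b nu xi k * c xi mu l) * RtoC (tc k l j))%C.
  apply: (cheb_expansion_linear (V := R_ModuleSpace) (W := C_R_ModuleSpace)
    (phi := fun r => RtoC (beta / 2) * (b nu xi k * c xi mu l) * RtoC r)%C).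
  - by move=> y z; rewrite RtoC_plus; exact: Cmult_plus_distr_l.
  - move=> r y; rewrite -[scal r y]/(Rmult r y) scal_R_Cmult RtoC_mult; C_ring.
  - exact: cheb_expansion_comp hxt (htc k l).
have := cheb_expansion_sum (index_enum I) (fun xi =>
  cheb_expansion_sum (index_enum 'I_K) (fun k =>
    cheb_expansion_sum (index_enum 'I_L) (fun l => Hterm k l xi))).
apply: cheb_expansion_ext => [t ht|j].
  rewrite hA //; apply: eq_bigr => xi _.
  exact: (is_RInt_unique (V := C_R_CompleteNormedModule)) (HI nu xi mu t ht).
(* The sum over [xi] is outermost here, as in the definition of A, but innermost in the stated
   coefficient; two exchanges move it inward while beta / 2 is distributed. *)
rewrite -[RHS]/(\csum_(xi in I) \csum_(k in 'I_K) \csum_(l in 'I_L)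
  (RtoC (beta / 2) * (b nu xi k * c xi mu l) * RtoC (tc k l j)))%C.
rewrite (big_morph (Cmult _) (Cmult_plus_distr_l _) (Cmult_0_r _)).
rewrite [RHS]exchange_big /=; apply: eq_bigr => k _.
rewrite (big_morph (Cmult _) (Cmult_plus_distr_l _) (Cmult_0_r _)).
rewrite [RHS]exchange_big /=; apply: eq_bigr => l _.
rewrite (big_morph (Cmult _) (Cmult_plus_distr_l _) (Cmult_0_r _)).
by apply: eq_bigr => xi _; C_ring.
Qed.
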